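(* If an s-hypersequent $\alpha_1\vdash\beta_1\mid\dots\mid\alpha_n\vdash\beta_n$ is valid in the class $\mathcal{KC}$ of all Kripke contexts, then it is provable in $\mathbf{MPDBL}$.
   Context: The logic PDBL. Variables: object variables $\mathbf{OV}$ ($p,\dots$) and property variables $\mathbf{PV}$ ($P,\dots$), disjoint countably infinite sets; constants $\top,\bot$; connectives $\sqcap,\sqcup$ (binary), $\neg,\lrcorner$ (unary). $\alpha\vee\beta:=\neg(\neg\alpha\sqcap\neg\beta)$, $\alpha\wedge\beta:=\lrcorner(\lrcorner\alpha\sqcup\lrcorner\beta)$. Sequents $\alpha\vdash\beta$ ($\alpha\dashv\vdash\beta$ means both directions); s-hypersequents are finite sequences $\alpha_1\vdash\beta_1\mid\dots\mid\alpha_n\vdash\beta_n$ (components); $B,C,\dots,X$ range over possibly empty s-hypersequents. Axioms: $\alpha\vdash\alpha$; $\alpha\sqcap\beta\vdash\alpha$; $\alpha\sqcap\beta\vdash\beta$; $\alpha\vdash\alpha\sqcup\beta$; $\beta\vdash\alpha\sqcup\beta$; $\alpha\sqcap\beta\vdash(\alpha\sqcap\beta)\sqcap(\alpha\sqcap\beta)$; $(\alpha\sqcup\beta)\sqcup(\alpha\sqcup\beta)\vdash\alpha\sqcup\beta$; $\neg(\alpha\sqcap\alpha)\vdash\neg\alpha$; $\lrcorner\alpha\vdash\lrcorner(\alpha\sqcup\alpha)$; $\alpha\sqcap\neg\alpha\vdash\bot$; $\top\vdash\alpha\sqcup\lrcorner\alpha$; $\neg\neg(\alpha\sqcap\beta)\dashv\vdash\alpha\sqcap\beta$;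 $\lrcorner\lrcorner(\alpha\sqcup\beta)\dashv\vdash\alpha\sqcup\beta$; $\alpha\sqcap\alpha\vdash\alpha\sqcap(\alpha\sqcup\beta)$; $\alpha\sqcup(\alpha\sqcap\beta)\vdash\alpha\sqcup\alpha$; $\alpha\sqcap\alpha\vdash\alpha\sqcap(\alpha\vee\beta)$; $\alpha\sqcup(\alpha\wedge\beta)\vdash\alpha\sqcup\alpha$; $\alpha\sqcap(\beta\vee\gamma)\dashv\vdash(\alpha\sqcap\beta)\vee(\alpha\sqcap\gamma)$; $\alpha\sqcup(\beta\wedge\gamma)\dashv\vdash(\alpha\sqcup\beta)\wedge(\alpha\sqcup\gamma)$; $\bot\vdash\alpha$; $\alpha\vdash\top$; $\neg\top\vdash\bot$; $\top\vdash\lrcorner\bot$; $\neg\bot\dashv\vdash\top\sqcap\top$; $\lrcorner\top\dashv\vdash\bot\sqcup\bot$; $(\alpha\sqcup\alpha)\sqcap(\alpha\sqcup\alpha)\dashv\vdash(\alpha\sqcap\alpha)\sqcup(\alpha\sqcap\alpha)$; $p\sqcap p\dashv\vdash p$ ($p\in\mathbf{OV}$); $P\sqcup P\dashv\vdash P$ ($P\in\mathbf{PV}$); (Sp) $\alpha\vdash\alpha\sqcap\alpha\mid\alpha\sqcup\alpha\vdash\alpha$. Rules: from $B\mid\alpha\vdash\beta\mid C$ infer $B\mid\alpha\sqcap\gamma\vdash\beta\sqcap\gamma\mid C$, $B\mid\gamma\sqcap\alpha\vdash\gamma\sqcap\beta\mid C$, $B\mid\alpha\sqcup\gamma\vdash\beta\sqcup\gamma\mid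 C$, $B\mid\gamma\sqcup\alpha\vdash\gamma\sqcup\beta\mid C$, $B\mid\neg\beta\vdash\neg\alpha\mid C$, $B\mid\lrcorner\beta\vdash\lrcorner\alpha\mid C$; from $B\mid\alpha\vdash\beta\mid C$ and $D\mid\beta\vdash\gamma\mid E$ infer $B\mid D\mid\alpha\vdash\gamma\mid C\mid E$; from $B\mid\alpha\sqcap\beta\vdash\alpha\sqcap\alpha\mid C$, $D\mid\alpha\sqcap\alpha\vdash\alpha\sqcap\beta\mid E$, $F\mid\alpha\sqcup\beta\vdash\beta\sqcup\beta\mid G$, $H\mid\beta\sqcup\beta\vdash\alpha\sqcup\beta\mid X$ infer $B\mid D\mid F\mid H\mid\alpha\vdash\beta\mid C\mid E\mid G\mid X$; external: from $B\mid D\mid D\mid C$ infer $B\mid D\mid C$; from $B\mid D\mid E\mid C$ infer $B\mid E\mid D\mid C$; from $B$ infer $B\mid C$. MPDBL. Add unary connectives $\square,\blacksquare$ (the PDBL schemes and rules range over all formulae of the enlarged language), with additional axioms $\square\alpha\sqcap\square\beta\dashv\vdash\square(\alpha\sqcap\beta)$; $\blacksquare\alpha\sqcup\blacksquare\beta\dashv\vdash\blacksquare(\alpha\sqcup\beta)$; $\square(\neg\bot)\dashv\vdash\neg\bot$; $\blacksquare(\lrcorner\top)\dashv\vdash\lrcorner\top$; $\square(\alpha\sqcap\alpha)\dashv\vdash\square\alpha$; $\blacksquare(\alpha\sqcup\alpha)\dashv\vdash\blacksquare\alpha$, and rules: from $B\mid\alpha\vdash\beta\mid C$ infer $B\mid\square\alpha\vdash\square\beta\mid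 C$ and $B\mid\blacksquare\alpha\vdash\blacksquare\beta\mid C$. Provability is via finite derivations. Kripke contexts and semiconcepts. A Kripke context is $\mathbb{KC}=((G,R),(M,S),I)$ where $(G,M,I)$ is a context ($I\subseteq G\times M$), $R$ is a binary relation on $G$ and $S$ a binary relation on $M$. For $A\subseteq G$, $A'=\{m:gIm\ \forall g\in A\}$; for $B\subseteq M$, $B'=\{g:gIm\ \forall m\in B\}$. A semiconcept of $(G,M,I)$ is a pair $(A,B)$ with $A'=B$ or $B'=A$; $ext(A,B)=A$, $int(A,B)=B$; $\mathfrak{H}$ denotes the set of semiconcepts with operations $(A_1,B_1)\sqcap(A_2,B_2)=(A_1\cap A_2,(A_1\cap A_2)')$, $(A_1,B_1)\sqcup(A_2,B_2)=((B_1\cap B_2)',B_1\cap B_2)$. Models. A model is $\mathbb{M}=(\mathbb{KC},v)$ with $v$ a map on $\mathbf{OV}\cup\mathbf{PV}\cup\{\top,\bot\}$ into $\mathfrak{H}$ with $v(p)\sqcap v(p)=v(p)$ ($p\in\mathbf{OV}$), $v(P)\sqcup v(P)=v(P)$ ($P\in\mathbf{PV}$), $v(\top)=(G,\emptyset)$, $v(\bot)=(\emptyset,M)$. Satisfaction $g\models\alpha$ ($g\in G$) and co-satisfaction $m\succ\alpha$ ($m\in M$): $g\models p$ iff $g\in ext(v(p))$; $g\models P$ iff $g\in ext(v(P))$; $g\models\top$ always; $g\not\models\bot$ always; $m\not\succ\top$ always; $m\succ\bot$ always; $g\models\alpha\sqcap\beta$ iff $g\models\alpha$ and $g\models\beta$;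 $g\models\neg\alpha$ iff $g\not\models\alpha$; $m\succ p$ iff $m\in int(v(p))$; $m\succ P$ iff $m\in int(v(P))$; $m\succ\alpha\sqcup\beta$ iff $m\succ\alpha$ and $m\succ\beta$; $m\succ\lrcorner\alpha$ iff $m\not\succ\alpha$; $g\models\alpha\sqcup\beta$ iff $\forall m(m\succ\alpha\sqcup\beta\Rightarrow gIm)$; $g\models\lrcorner\alpha$ iff $\forall m(m\not\succ\alpha\Rightarrow gIm)$; $m\succ\neg\alpha$ iff $\forall g(g\not\models\alpha\Rightarrow gIm)$; $m\succ\alpha\sqcap\beta$ iff $\forall g(g\models\alpha\sqcap\beta\Rightarrow gIm)$; $g\models\square\alpha$ iff for all $g_1$ with $gRg_1$, $g_1\models\alpha$; $m\succ\square\alpha$ iff $gIm$ for every $g\in G$ such that ($g_1\models\alpha$ for all $g_1$ with $gRg_1$); $m\succ\blacksquare\alpha$ iff for all $m_1$ with $mSm_1$, $m_1\succ\alpha$; $g\models\blacksquare\alpha$ iff $gIm$ for every $m\in M$ such that ($m_1\succ\alpha$ for all $m_1$ with $mSm_1$). A sequent $\alpha\vdash\beta$ is satisfied in $\mathbb{M}$ iff $\forall g(g\models\alpha\Rightarrow g\models\beta)$ and $\forall m(m\succ\beta\Rightarrow m\succ\alpha)$; an s-hypersequent is satisfied iff some component is; true in $\mathbb{KC}$ iff satisfied in every model based on $\mathbb{KC}$; valid in a class iff true in each member. *)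

(* Defs.v *)
From Stdlib Require List.
From mathcomp Require Import all_boot.
From mathcomp Require Import classical_sets.

Set Implicit Arguments.
Unset Strict Implicit.
Unset Printing Implicit Defensive.

Declare Scope mpdbl_scope.
Delimit Scope mpdbl_scope with mpdbl.
Local Open Scope classical_set_scope.
Local Open Scope mpdbl_scope.

(* The domain of a valuation: the object variables Ov 0, Ov 1, ..., the
   property variables Pv 0, Pv 1, ..., and the two constants. *)
Inductive atom : Set :=
  | Ov of nat
  | Pv of nat
  | Top
  | Bot.

Inductive formula : Set :=
  | Atom of atom
  | Meet of formula & formula
  | Join of formula & formula
  | Neg of formula
  | Opp of formula
  | Box of formula
  | BBox of formula.

Notation "⊤" := (Atom Top) : mpdbl_scope.
Notation "⊥" := (Atom Bot) : mpdbl_scope.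
Notation "¬ a" := (Neg a) (at level 35, right associativity) : mpdbl_scope.
Notation "⌟ a" := (Opp a) (at level 35, right associativity) : mpdbl_scope.
Notation "□ a" := (Box a) (at level 35, right associativity) : mpdbl_scope.
Notation "■ a" := (BBox a) (at level 35, right associativity) : mpdbl_scope.
Notation "a ⊓ b" := (Meet a b) (at level 40, left associativity) : mpdbl_scope.
Notation "a ⊔ b" := (Join a b) (at level 40, left associativity) : mpdbl_scope.

Definition fvee (a b : formula) : formula := ¬ (¬ a ⊓ ¬ b).
Definition fwedge (a b : formula) : formula := ⌟ (⌟ a ⊔ ⌟ b).

Notation "a ∨ b" := (fvee a b) (at level 50, left associativity) : mpdbl_scope.
Notation "a ∧ b" := (fwedge a b) (at level 50, left associativity) : mpdbl_scope.

Inductive sequent : Set := Sequent of formula & formula.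

Notation "a ⊢ b" := (Sequent a b) (at level 60, no associativity) : mpdbl_scope.

(* The components of an s-hypersequent, in order; juxtaposition B | C is
   B ++ C. *)
Definition hypersequent := seq sequent.

(* The axioms that consist of one sequent. An axiom with ⊣⊢ is split into two
   constructors, with suffixes _l (left to right) and _r (right to left). *)
Inductive axiom : sequent -> Prop :=
  | ax_id a : axiom (a ⊢ a)
  | ax_meet1 a b : axiom (a ⊓ b ⊢ a)
  | ax_meet2 a b : axiom (a ⊓ b ⊢ b)
  | ax_join1 a b : axiom (a ⊢ a ⊔ b)
  | ax_join2 a b : axiom (b ⊢ a ⊔ b)
  | ax_meet_idem a b : axiom (a ⊓ b ⊢ (a ⊓ b) ⊓ (a ⊓ b))
  | ax_join_idem a b : axiom ((a ⊔ b) ⊔ (a ⊔ b) ⊢ a ⊔ b)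
  | ax_neg_meet a : axiom (¬ (a ⊓ a) ⊢ ¬ a)
  | ax_opp_join a : axiom (⌟ a ⊢ ⌟ (a ⊔ a))
  | ax_meet_neg a : axiom (a ⊓ ¬ a ⊢ ⊥)
  | ax_join_opp a : axiom (⊤ ⊢ a ⊔ ⌟ a)
  | ax_negneg_l a b : axiom (¬ ¬ (a ⊓ b) ⊢ a ⊓ b)
  | ax_negneg_r a b : axiom (a ⊓ b ⊢ ¬ ¬ (a ⊓ b))
  | ax_oppopp_l a b : axiom (⌟ ⌟ (a ⊔ b) ⊢ a ⊔ b)
  | ax_oppopp_r a b : axiom (a ⊔ b ⊢ ⌟ ⌟ (a ⊔ b))
  | ax_absorb_meet_join a b : axiom (a ⊓ a ⊢ a ⊓ (a ⊔ b))
  | ax_absorb_join_meet a b : axiom (a ⊔ (a ⊓ b) ⊢ a ⊔ a)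
  | ax_absorb_meet_vee a b : axiom (a ⊓ a ⊢ a ⊓ (a ∨ b))
  | ax_absorb_join_wedge a b : axiom (a ⊔ (a ∧ b) ⊢ a ⊔ a)
  | ax_distr_meet_l a b c : axiom (a ⊓ (b ∨ c) ⊢ (a ⊓ b) ∨ (a ⊓ c))
  | ax_distr_meet_r a b c : axiom ((a ⊓ b) ∨ (a ⊓ c) ⊢ a ⊓ (b ∨ c))
  | ax_distr_join_l a b c : axiom (a ⊔ (b ∧ c) ⊢ (a ⊔ b) ∧ (a ⊔ c))
  | ax_distr_join_r a b c : axiom ((a ⊔ b) ∧ (a ⊔ c) ⊢ a ⊔ (b ∧ c))
  | ax_bot a : axiom (⊥ ⊢ a)
  | ax_top a : axiom (a ⊢ ⊤)
  | ax_neg_top : axiom (¬ ⊤ ⊢ ⊥)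
  | ax_opp_bot : axiom (⊤ ⊢ ⌟ ⊥)
  | ax_neg_bot_l : axiom (¬ ⊥ ⊢ ⊤ ⊓ ⊤)
  | ax_neg_bot_r : axiom (⊤ ⊓ ⊤ ⊢ ¬ ⊥)
  | ax_opp_top_l : axiom (⌟ ⊤ ⊢ ⊥ ⊔ ⊥)
  | ax_opp_top_r : axiom (⊥ ⊔ ⊥ ⊢ ⌟ ⊤)
  | ax_mixed_l a : axiom ((a ⊔ a) ⊓ (a ⊔ a) ⊢ (a ⊓ a) ⊔ (a ⊓ a))
  | ax_mixed_r a : axiom ((a ⊓ a) ⊔ (a ⊓ a) ⊢ (a ⊔ a) ⊓ (a ⊔ a))
  | ax_ov_l n : axiom (Atom (Ov n) ⊓ Atom (Ov n) ⊢ Atom (Ov n))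
  | ax_ov_r n : axiom (Atom (Ov n) ⊢ Atom (Ov n) ⊓ Atom (Ov n))
  | ax_pv_l n : axiom (Atom (Pv n) ⊔ Atom (Pv n) ⊢ Atom (Pv n))
  | ax_pv_r n : axiom (Atom (Pv n) ⊢ Atom (Pv n) ⊔ Atom (Pv n))
  | ax_box_meet_l a b : axiom (□ a ⊓ □ b ⊢ □ (a ⊓ b))
  | ax_box_meet_r a b : axiom (□ (a ⊓ b) ⊢ □ a ⊓ □ b)
  | ax_bbox_join_l a b : axiom (■ a ⊔ ■ b ⊢ ■ (a ⊔ b))
  | ax_bbox_join_r a b : axiom (■ (a ⊔ b) ⊢ ■ a ⊔ ■ b)
  | ax_box_neg_bot_l : axiom (□ (¬ ⊥) ⊢ ¬ ⊥)
  | ax_box_neg_bot_r : axiom (¬ ⊥ ⊢ □ (¬ ⊥))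
  | ax_bbox_opp_top_l : axiom (■ (⌟ ⊤) ⊢ ⌟ ⊤)
  | ax_bbox_opp_top_r : axiom (⌟ ⊤ ⊢ ■ (⌟ ⊤))
  | ax_box_idem_l a : axiom (□ (a ⊓ a) ⊢ □ a)
  | ax_box_idem_r a : axiom (□ a ⊢ □ (a ⊓ a))
  | ax_bbox_idem_l a : axiom (■ (a ⊔ a) ⊢ ■ a)
  | ax_bbox_idem_r a : axiom (■ a ⊢ ■ (a ⊔ a)).

Inductive provable : hypersequent -> Prop :=
  | pr_axiom s : axiom s -> provable [:: s]
  | pr_Sp a : provable [:: a ⊢ a ⊓ a; a ⊔ a ⊢ a]
  | pr_meetr B C a b c : provable (B ++ [:: a ⊢ b] ++ C) ->
      provable (B ++ [:: a ⊓ c ⊢ b ⊓ c] ++ C)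
  | pr_meetl B C a b c : provable (B ++ [:: a ⊢ b] ++ C) ->
      provable (B ++ [:: c ⊓ a ⊢ c ⊓ b] ++ C)
  | pr_joinr B C a b c : provable (B ++ [:: a ⊢ b] ++ C) ->
      provable (B ++ [:: a ⊔ c ⊢ b ⊔ c] ++ C)
  | pr_joinl B C a b c : provable (B ++ [:: a ⊢ b] ++ C) ->
      provable (B ++ [:: c ⊔ a ⊢ c ⊔ b] ++ C)
  | pr_neg B C a b : provable (B ++ [:: a ⊢ b] ++ C) ->
      provable (B ++ [:: ¬ b ⊢ ¬ a] ++ C)
  | pr_opp B C a b : provable (B ++ [:: a ⊢ b] ++ C) ->
      provable (B ++ [:: ⌟ b ⊢ ⌟ a] ++ C)
  | pr_trans B C D E a b c :
      provable (B ++ [:: a ⊢ b] ++ C) ->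
      provable (D ++ [:: b ⊢ c] ++ E) ->
      provable (B ++ D ++ [:: a ⊢ c] ++ C ++ E)
  | pr_order B C D E F G H X a b :
      provable (B ++ [:: a ⊓ b ⊢ a ⊓ a] ++ C) ->
      provable (D ++ [:: a ⊓ a ⊢ a ⊓ b] ++ E) ->
      provable (F ++ [:: a ⊔ b ⊢ b ⊔ b] ++ G) ->
      provable (H ++ [:: b ⊔ b ⊢ a ⊔ b] ++ X) ->
      provable (B ++ D ++ F ++ H ++ [:: a ⊢ b] ++ C ++ E ++ G ++ X)
  | pr_contraction B C D : provable (B ++ D ++ D ++ C) ->
      provable (B ++ D ++ C)
  | pr_exchange B C D E : provable (B ++ D ++ E ++ C) ->
      provable (B ++ E ++ D ++ C)
  | pr_weakening B C : provable B -> provable (B ++ C)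
  | pr_box B C a b : provable (B ++ [:: a ⊢ b] ++ C) ->
      provable (B ++ [:: □ a ⊢ □ b] ++ C)
  | pr_bbox B C a b : provable (B ++ [:: a ⊢ b] ++ C) ->
      provable (B ++ [:: ■ a ⊢ ■ b] ++ C).

(* The sets of objects and of properties may be empty. *)
Record kripke_context := KripkeContext {
  obj : Type;
  prop : Type;
  relR : obj -> obj -> Prop;
  relS : prop -> prop -> Prop;
  inc : obj -> prop -> Prop }.

Section Semantics.
Variable K : kripke_context.
Implicit Types (A : set (obj K)) (B : set (prop K)).

Definition up A : set (prop K) := [set m | forall g, A g -> inc g m].
Definition down B : set (obj K) := [set g | forall m, B m -> inc g m].

(* A pair (A, B), with ext (A, B) = A and int (A, B) = B. *)
Definition pre_concept := (set (obj K) * set (prop K))%type.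

Definition is_semiconcept (x : pre_concept) : Prop :=
  up x.1 = x.2 \/ down x.2 = x.1.

Definition sc_meet (x y : pre_concept) : pre_concept :=
  (x.1 `&` y.1, up (x.1 `&` y.1)).

Definition sc_join (x y : pre_concept) : pre_concept :=
  (down (x.2 `&` y.2), x.2 `&` y.2).

Record model := Model {
  mval :> atom -> pre_concept;
  mval_semiconcept : forall x, is_semiconcept (mval x);
  mval_ov : forall n, sc_meet (mval (Ov n)) (mval (Ov n)) = mval (Ov n);
  mval_pv : forall n, sc_join (mval (Pv n)) (mval (Pv n)) = mval (Pv n);
  mval_top : mval Top = (setT, set0);
  mval_bot : mval Bot = (set0, setT) }.

Variable v : model.

(* In the clauses that refer to the dual relation at the same formula (⊔, ■
   for sat and ⊓, □ for cosat), that relation is unfolded, which makes the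
   recursion structural. *)
Fixpoint sat (a : formula) (g : obj K) {struct a} : Prop :=
  match a with
  | Atom (Ov n) => (v (Ov n)).1 g
  | Atom (Pv n) => (v (Pv n)).1 g
  | Atom Top => True
  | Atom Bot => False
  | Meet a b => sat a g /\ sat b g
  | Join a b => forall m, cosat a m /\ cosat b m -> inc g m
  | Neg a => ~ sat a g
  | Opp a => forall m, ~ cosat a m -> inc g m
  | Box a => forall g1, relR g g1 -> sat a g1
  | BBox a => forall m, (forall m1, relS m m1 -> cosat a m1) -> inc g m
  end
with cosat (a : formula) (m : prop K) {struct a} : Prop :=
  match a with
  | Atom (Ov n) => (v (Ov n)).2 m
  | Atom (Pv n) => (v (Pv n)).2 m
  | Atom Top => False
  | Atom Bot => True
  | Meet a b => forall g, sat a g /\ sat b g -> inc g m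
  | Join a b => cosat a m /\ cosat b m
  | Neg a => forall g, ~ sat a g -> inc g m
  | Opp a => ~ cosat a m
  | Box a => forall g, (forall g1, relR g g1 -> sat a g1) -> inc g m
  | BBox a => forall m1, relS m m1 -> cosat a m1
  end.

Definition sat_sequent (s : sequent) : Prop :=
  let: Sequent a b := s in
  (forall g, sat a g -> sat b g) /\ (forall m, cosat b m -> cosat a m).

Definition sat_hypersequent (H : hypersequent) : Prop :=
  exists2 s, List.In s H & sat_sequent s.

End Semantics.

Definition true_in (K : kripke_context) (H : hypersequent) : Prop :=
  forall v : model K, sat_hypersequent v H.

Definition valid (C : set kripke_context) (H : hypersequent) : Prop :=
  forall K, C K -> true_in K H.

(* Main.v *)
(** Call a sequent provable when it is provable as a one-component
    hypersequent. The provable sequents preorder the formulae, and the canonical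
    Kripke context of this preorder has as objects the prime filters for
    [⊓, ¬] and as properties the prime ideals for [⊔, ⌟], an object being
    incident with a property when the two sets meet. In the canonical model a
    formula is satisfied exactly by the filters, and co-satisfied exactly by the
    ideals, that contain it, so a sequent that holds there is provable. A valid
    hypersequent has a component that holds in the canonical model, and it
    follows from that component by weakening; in particular no prime extension
    of the set of provable hypersequents is needed. *)
Require Import Defs.
From mathcomp Require Import all_boot.
From mathcomp Require Import boolp classical_sets.

Set Implicit Arguments.
Unset Strict Implicit.
Unset Printing Implicit Defensive.

Local Open Scope classical_set_scope.
Local Open Scope mpdbl_scope.

(* The fragment [⊓, ¬, □, ⊤, ⊥] of the algebra; the fragment [⊔, ⌟, ■, ⊥, ⊤]
   is another instance, for the converse order. *)
Record half (X : Type) := Half {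
  le : X -> X -> Prop;
  meet : X -> X -> X;
  neg : X -> X;
  box : X -> X;
  top : X;
  bot : X;
  le_refl : forall a, le a a;
  le_trans : forall b a c, le a b -> le b c -> le a c;
  meet_lel : forall a b, le (meet a b) a;
  meet_ler : forall a b, le (meet a b) b;
  meet_idem : forall a b, le (meet a b) (meet (meet a b) (meet a b));
  meet_mono : forall a b c d, le a b -> le c d -> le (meet a c) (meet b d);
  neg_anti : forall a b, le a b -> le (neg b) (neg a);
  neg_meet : forall a, le (neg (meet a a)) (neg a);
  meet_neg : forall a, le (meet a (neg a)) bot;
  negneg_le : forall a b, le (neg (neg (meet a b))) (meet a b);
  distr : forall a b c,
    le (meet a (neg (meet (neg b) (neg c))))
       (neg (meet (neg (meet a b)) (neg (meet a c))));
  bot_le : forall a, le bot a;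
  le_top : forall a, le a top;
  top_neg_bot : le (meet top top) (neg bot);
  box_mono : forall a b, le a b -> le (box a) (box b);
  box_meet_le : forall a b, le (meet (box a) (box b)) (box (meet a b));
  le_box_meet : forall a b, le (box (meet a b)) (meet (box a) (box b));
  box_idem : forall a, le (box a) (box (meet a a));
  box_neg_bot : le (neg bot) (box (neg bot)) }.

(** * Filters, ideals and derived laws in one half *)

Section Half.
Variables (X : Type) (D : half X).
Implicit Types (a b c u : X) (F J U : set X).
Local Notation "a ⊑ b" := (le D a b) (at level 70).

Record filter F : Prop := {
  filter_up : forall a b, F a -> a ⊑ b -> F b;
  filter_meet : forall a b, F a -> F b -> F (meet D a b) }.

(** Directedness stands in for closure under joins: the disjunction derived from [meet] and [neg]
    need not lie above its arguments. *)
Record ideal J : Prop := {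
  ideal_down : forall a b, J b -> a ⊑ b -> J a;
  ideal_directed : forall a b, J a -> J b ->
    exists c, [/\ J c, a ⊑ c & b ⊑ c];
  ideal_bot : J (bot D) }.

Record ultrafilter U : Prop := {
  ultra_filter :> filter U;
  ultra_bot : ~ U (bot D);
  ultra_compl : forall a, U a \/ U (neg D a) }.

(** Since [c] need not lie below [meet D c c], the universal property of a meet is available only
    for idempotent [c]. *)
Lemma le_meet c a b : c ⊑ meet D c c -> c ⊑ a -> c ⊑ b -> c ⊑ meet D a b.
Proof. by move=> cc ca cb; apply: le_trans cc _; exact: meet_mono. Qed.

Lemma meet_idem_le a b c d :
  meet D a b ⊑ c -> meet D a b ⊑ d -> meet D a b ⊑ meet D c d.
Proof. by apply: le_meet; exact: meet_idem. Qed.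

(* [w := ¬(a ⊓ a)] satisfies [w = ¬¬w = ¬¬(w ⊓ w) = w ⊓ w]. *)
Lemma neg_idem a : neg D a ⊑ meet D (neg D a) (neg D a).
Proof.
set y := meet D a a; set w := neg D y.
have aw : neg D a ⊑ w by apply: neg_anti; exact: meet_lel.
have wa : w ⊑ neg D a by exact: neg_meet.
have ww : w ⊑ meet D w w.
  apply: (@le_trans _ D (neg D (neg D w))).
    by apply: neg_anti; exact: negneg_le.
  apply: le_trans (negneg_le D _ _).
  by apply: neg_anti; exact: neg_meet.
by apply: le_trans aw _; apply: le_trans ww _; exact: meet_mono.
Qed.

(** As [neg D c] is idempotent, it lies below the meet of [neg D a] and [neg D b]. Negating once
    more leaves [neg D (neg D c)], which lies below [meet D c c]. *)
Lemma vee_le a b c : a ⊑ c -> b ⊑ c ->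
  neg D (meet D (neg D a) (neg D b)) ⊑ c.
Proof.
move=> ac bc; apply: (@le_trans _ D (neg D (neg D c))).
  by apply: neg_anti; apply: le_meet; [exact: neg_idem|exact: neg_anti..].
apply: (@le_trans _ D (neg D (neg D (meet D c c)))).
  by apply: neg_anti; exact: neg_meet.
by apply: le_trans (negneg_le _ _ _) _; exact: meet_lel.
Qed.

(** Distributivity of [u] over the disjunction of [a] and [neg D a], which lies above the meet of
    [top D] with itself. *)
Lemma le_excluded_middle u a c :
  meet D u a ⊑ c -> meet D u (neg D a) ⊑ c -> meet D u u ⊑ c.
Proof.
move=> uac unac; apply: le_trans (vee_le uac unac).
apply: le_trans (distr _ _ _ _).
apply: meet_idem_le; first exact: meet_lel.
apply: (@le_trans _ D (meet D (top D) (top D))).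
  by apply: meet_mono; exact: le_top.
apply: le_trans (top_neg_bot D) _.
by apply: neg_anti; exact: meet_neg.
Qed.

(** * Generated filters and the prime filter theorem *)

Lemma filter_adjoin F a : filter F ->
  filter [set x | exists2 u, F u & meet D u a ⊑ x].
Proof.
move=> Ff; split=> [x y [u Fu ux] xy|x y [u Fu ux] [w Fw wy]].
  by exists u => //; exact: le_trans ux xy.
exists (meet D u w); first exact: filter_meet.
apply: meet_idem_le.
  by apply: le_trans ux; apply: meet_mono; [exact: meet_lel|exact: le_refl].
by apply: le_trans wy; apply: meet_mono; [exact: meet_ler|exact: le_refl].
Qed.

(** The bound is [meet D a a] because the elements above a non-idempotent [a] need not be closed
    under [meet]. *)
Lemma principal_filter a : filter [set x | meet D a a ⊑ x].
Proof.
split=> [x y /= ax xy|x y /= ax ay]; first exact: le_trans ax xy.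
exact: meet_idem_le.
Qed.

Lemma principal_ideal a : ideal [set x | x ⊑ a].
Proof.
split=> [x y /= ya xy|x y /= xa ya|]; first exact: le_trans xy ya.
  by exists a; split=> //; exact: le_refl.
exact: bot_le.
Qed.

Lemma ultra_top U : ultrafilter U -> U (top D).
Proof.
move=> Uu; case: (ultra_compl Uu (top D)) => // Un.
by apply: (filter_up Uu Un); exact: le_top.
Qed.

Lemma ultra_negP U a : ultrafilter U -> U (neg D a) <-> ~ U a.
Proof.
move=> Uu; split=> [Una Ua|nUa]; last by case: (ultra_compl Uu a).
apply: (ultra_bot Uu); apply: (filter_up Uu _ (meet_neg D a)).
exact: (filter_meet Uu).
Qed.

Lemma ultra_meetP U a b : ultrafilter U -> U (meet D a b) <-> U a /\ U b.
Proof.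
move=> Uu; split=> [Uab|[Ua Ub]]; last exact: (filter_meet Uu).
by split; apply: (filter_up Uu Uab); [exact: meet_lel|exact: meet_ler].
Qed.

(** A filter maximal among those that contain [F] and avoid [J] decides every element. The member
    [f] prevents the empty set from being maximal. *)
Lemma separation F J f : filter F -> F f -> ideal J ->
  (forall a, F a -> ~ J a) ->
  exists U, [/\ ultrafilter U, forall a, F a -> U a & forall a, U a -> ~ J a].
Proof.
move=> Ff Ffn Ji FJ.
pose good U := [/\ filter U, forall a, F a -> U a & forall a, U a -> ~ J a].
(* The empty set is admitted because [Zorn_bigcup] also asks for the union of
   the empty chain. *)
have [|U [goodU maxU]] := @Zorn_bigcup _ [set U | U = set0 \/ good U].
  move=> C Cgood Ctot /=.
  have mem_good V a : C V -> V a -> good V.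
    by move=> CV Va; case: (Cgood V CV) => // V0; rewrite V0 in Va.
  have [[a [V CV Va]]|nC] := pselect (exists a, (\bigcup_(V in C) V) a); last first.
    by left; apply/seteqP; split=> // a Ca; apply: nC; exists a.
  right; split.
  - split=> [x y [W CW Wx] xy|x y [W CW Wx] [W' CW' W'y]].
      by exists W => //; have [Wf _ _] := mem_good _ _ CW Wx;
        exact: (filter_up Wf Wx xy).
    have [Wf _ _] := mem_good _ _ CW Wx; have [W'f _ _] := mem_good _ _ CW' W'y.
    have [WW'|W'W] := Ctot _ _ CW CW'.
      by exists W' => //; apply: filter_meet => //; exact: WW'.
    by exists W => //; apply: filter_meet => //; exact: W'W.
  - by move=> b Fb; exists V => //; have [_ + _] := mem_good _ _ CV Va; apply.
  - by move=> b [W CW Wb]; have [_ _ +] := mem_good _ _ CW Wb; apply.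
have {goodU} [Uf FU UJ] : good U.
  case: goodU => // U0; exfalso; apply: (maxU F); last by right; split.
  by rewrite U0; split=> // /(_ _ Ffn).
exists U; split=> //; split=> //.
  by move=> /UJ; apply; exact: ideal_bot.
move=> a; apply: contrapT => /not_orP[nUa nUna].
(* By maximality, adjoining a missing [b] to [U] yields a filter that meets [J]. *)
have hits b : ~ U b -> exists u c, [/\ U u, J c & meet D u b ⊑ c].
  move=> nUb; pose U' := [set x | exists2 u, U u & meet D u b ⊑ x].
  have UU' : U `<=` U' by move=> x Ux; exists x => //; exact: meet_lel.
  apply: contrapT => nhit; apply: (maxU U').
    split=> // /(_ b) U'U; apply: nUb; apply: U'U.
    by exists f; [exact: FU|exact: meet_ler].
  right; split; first exact: filter_adjoin.
    by move=> x /FU /UU'.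
  by move=> x [u Uu ux] Jx; apply: nhit; exists u, x.
have [u [b [Uu Jb ub]]] := hits _ nUa.
have [w [c [Uw Jc wc]]] := hits _ nUna.
(* A common bound [d] in [J] of both witnesses lies, by excluded middle on [a], above an element of
   [U]. *)
have [d [Jd bd cd]] := ideal_directed Ji Jb Jc.
have Uuw : U (meet D u w) by exact: filter_meet.
apply: (UJ (meet D (meet D u w) (meet D u w))); first exact: filter_meet.
apply: (ideal_down Ji Jd); apply: (@le_excluded_middle _ a).
  apply: le_trans bd; apply: le_trans ub; apply: meet_mono (le_refl D a).
  exact: meet_lel.
apply: le_trans cd; apply: le_trans wc; apply: meet_mono (le_refl D _).
exact: meet_ler.
Qed.

(** If [J] omits [a], then it avoids the principal filter of [a], by idempotence, and separation
    gives an ultrafilter containing [a] that misses [J]. *)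
Lemma ultra_idem_meets J a : ideal J -> a ⊑ meet D a a ->
  (forall U, ultrafilter U -> U a -> exists b, U b /\ J b) <-> J a.
Proof.
move=> Ji aa; split=> [meets|Ja U Uu Ua]; last by exists a.
apply: contrapT => nJa.
have [b ab Jb|U [Uu aU UJ]] :=
    separation (principal_filter a) (le_refl D (meet D a a)) Ji.
  by apply: nJa; apply: (ideal_down Ji Jb); exact: le_trans aa ab.
have [|b [Ub]] := meets U Uu; last exact: UJ.
by apply: (filter_up Uu _ (meet_lel D a a)); apply: aU; exact: le_refl.
Qed.

(** The elements whose box is in [U] form a filter, nonempty because it contains [neg D (bot D)]. If
    [box D a] is not in [U], separate this filter from the principal ideal of [a]. *)
Lemma ultra_boxP U a : ultrafilter U ->
  (forall U', ultrafilter U' -> (forall b, U (box D b) -> U' b) -> U' a) <->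
  U (box D a).
Proof.
move=> Uu; split=> [UU'|Ua U' _ UU']; last exact: UU'.
apply: contrapT => nUa.
have Ff : filter [set b | U (box D b)].
  split=> b c /=.
    by move=> Ub bc; apply: (filter_up Uu Ub); exact: box_mono.
  move=> Ub Uc; apply: (filter_up Uu _ (box_meet_le D b c)).
  exact: (filter_meet Uu).
have Fn : [set b | U (box D b)] (neg D (bot D)).
  apply: (filter_up Uu _ (box_neg_bot D)).
  by apply/ultra_negP => //; exact: ultra_bot.
have [|U' [U'u FU' U'a]] := separation Ff Fn (principal_ideal a).
  by move=> b /= Ub ba; apply: nUa; apply: (filter_up Uu Ub); exact: box_mono.
by apply: (U'a a); [exact: UU'|exact: le_refl].
Qed.

Lemma box_meet_idem a : box D a ⊑ meet D (box D a) (box D a).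
Proof. by apply: le_trans (box_idem D a) _; exact: le_box_meet. Qed.

(** Filters cannot tell [a] from [meet D a a], so the conclusion bounds only the latter. *)
Lemma ultra_complete a b :
  (forall U, ultrafilter U -> U a -> U b) -> meet D a a ⊑ b.
Proof.
move=> ab; apply: contrapT => nab.
have [|U [Uu aU Ub]] :=
    separation (principal_filter a) (le_refl D (meet D a a)) (principal_ideal b).
  by move=> x /= ax xb; apply: nab; exact: le_trans ax xb.
apply: (Ub b); last exact: le_refl.
apply: ab => //; apply: (filter_up Uu _ (meet_lel D a a)).
by apply: aU; exact: le_refl.
Qed.

End Half.

(** * The two halves of the provability preorder *)

Definition prov (a b : formula) : Prop := provable [:: a ⊢ b].

Lemma prov_ax a b : Defs.axiom (a ⊢ b) -> prov a b.
Proof. exact: pr_axiom. Qed.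

Lemma prov_trans b a c : prov a b -> prov b c -> prov a c.
Proof. exact: (@pr_trans [::] [::] [::] [::]). Qed.

Lemma prov_meet a b c d : prov a b -> prov c d -> prov (a ⊓ c) (b ⊓ d).
Proof.
move=> ab cd; apply: (@prov_trans (b ⊓ c)).
  exact: (@pr_meetr [::] [::]).
exact: (@pr_meetl [::] [::]).
Qed.

Lemma prov_join a b c d : prov a b -> prov c d -> prov (a ⊔ c) (b ⊔ d).
Proof.
move=> ab cd; apply: (@prov_trans (b ⊔ c)).
  exact: (@pr_joinr [::] [::]).
exact: (@pr_joinl [::] [::]).
Qed.

Definition lower : half formula.
Proof.
refine (@Half formula prov Meet Neg Box ⊤ ⊥ _ prov_trans _ _ _ prov_meet
  (fun a b => @pr_neg [::] [::] a b) _ _ _ _ _ _ _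
  (fun a b => @pr_box [::] [::] a b) _ _ _ _);
by move=> *; apply: prov_ax; constructor.
Defined.

Definition upper : half formula.
Proof.
refine (@Half formula (fun a b => prov b a) Join Opp BBox ⊥ ⊤ _
  (fun b a c ba cb => prov_trans cb ba) _ _ _
  (fun a b c d => @prov_join b a d c)
  (fun a b => @pr_opp [::] [::] b a) _ _ _ _ _ _ _
  (fun a b => @pr_bbox [::] [::] b a) _ _ _ _);
by move=> *; apply: prov_ax; constructor.
Defined.

Lemma ideal_of_upper (V : set formula) : ultrafilter upper V -> ideal lower V.
Proof.
move=> Vu; split=> [a b Vb ab|a b Va Vb|]; last exact: (ultra_top Vu).
  exact: (filter_up Vu Vb).
exists (a ⊔ b); split; first exact: (filter_meet Vu).
  exact: (meet_lel upper).
exact: (meet_ler upper).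
Qed.

Lemma ideal_of_lower (U : set formula) : ultrafilter lower U -> ideal upper U.
Proof.
move=> Uu; split=> [a b Ub ab|a b Ua Ub|]; last exact: (ultra_top Uu).
  exact: (filter_up Uu Ub).
exists (a ⊓ b); split; first exact: (filter_meet Uu).
  exact: (meet_lel lower).
exact: (meet_ler lower).
Qed.

(** * The canonical model and completeness *)

(* Writing [set formula] here would raise a universe inconsistency, since
   [valid] forms [set kripke_context]. *)
Definition canonical_context : kripke_context := {|
  obj := {U : formula -> Prop | ultrafilter lower U};
  Defs.prop := {V : formula -> Prop | ultrafilter upper V};
  relR U U' := forall a, sval U (□ a) -> sval U' a;
  relS V V' := forall a, sval V (■ a) -> sval V' a;
  inc U V := exists a, sval U a /\ sval V a |}.

Definition canonical_val (a : formula) : pre_concept canonical_context :=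
  ([set U : obj canonical_context | sval U a],
   [set V : Defs.prop canonical_context | sval V a]).

(** An ultrafilter of [upper] is an ideal of [lower], so [ultra_idem_meets] applies. *)
Lemma inc_lower (a : formula) (V : Defs.prop canonical_context) :
  prov a (a ⊓ a) ->
  (forall U : obj canonical_context, sval U a -> inc U V) <-> sval V a.
Proof.
move=> aa; case: V => V Vu /=.
apply: iff_trans (ultra_idem_meets (ideal_of_upper Vu) aa).
by split=> [h U Uu|h [U Uu] Ua]; [exact: (h (exist _ U Uu))|exact: (h U Uu Ua)].
Qed.

Lemma inc_upper (a : formula) (U : obj canonical_context) :
  prov (a ⊔ a) a ->
  (forall V : Defs.prop canonical_context, sval V a -> inc U V) <-> sval U a.
Proof.
move=> aa; case: U => U Uu /=.
apply: iff_trans (@ultra_idem_meets _ upper _ _ (ideal_of_lower Uu) aa).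
split=> [h V Vu Va|h [V Vu] Va].
  by have [b [Ub Vb]] := h (exist _ V Vu) Va; exists b.
by have [b [Vb Ub]] := h V Vu Va; exists b.
Qed.

Lemma up_canonical a : prov a (a ⊓ a) ->
  Defs.up (canonical_val a).1 = (canonical_val a).2.
Proof. by move=> aa; apply/seteqP; split=> V /(inc_lower V aa). Qed.

Lemma down_canonical a : prov (a ⊔ a) a ->
  Defs.down (canonical_val a).2 = (canonical_val a).1.
Proof. by move=> aa; apply/seteqP; split=> U /(inc_upper U aa). Qed.

Lemma canonical_top : canonical_val ⊤ = (setT, set0).
Proof.
congr pair; apply/seteqP; split=> // -[W Ww] //=.
  by move=> _; exact: (ultra_top Ww).
exact: (ultra_bot Ww).
Qed.

Lemma canonical_bot : canonical_val ⊥ = (set0, setT).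
Proof.
congr pair; apply/seteqP; split=> // -[W Ww] //=.
  exact: (ultra_bot Ww).
by move=> _; exact: (ultra_top Ww).
Qed.

Definition canonical_model : model canonical_context.
Proof.
refine (@Model canonical_context (fun x => canonical_val (Atom x))
  _ _ _ canonical_top canonical_bot).
(* Object variables are [⊓]-idempotent and property variables [⊔]-idempotent. For [⊤] the empty
   intent determines the extent, and dually for [⊥]. *)
- case=> [n|n||].
  + by left; apply: up_canonical; apply: prov_ax; constructor.
  + by right; apply: down_canonical; apply: prov_ax; constructor.
  + by right; rewrite canonical_top; apply/seteqP; split=> // g _ m [].
  + by left; rewrite canonical_bot; apply/seteqP; split=> // m _ g [].
- move=> n; rewrite /sc_meet setIid up_canonical //.
  by apply: prov_ax; constructor.
- move=> n; rewrite /sc_join setIid down_canonical //.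
  by apply: prov_ax; constructor.
Defined.

(** Each connective has one direct clause, matched by an ultrafilter property. Its other clause is
    the polar of the first, and [inc_lower] or [inc_upper] settles it because the compound formula
    is idempotent. *)
Lemma truth (a : formula) :
  (forall U, sat canonical_model a U <-> sval U a) /\
  (forall V, cosat canonical_model a V <-> sval V a).
Proof.
elim: a => [[n|n||]|a [sa ca] b [sb cb]|a [sa ca] b [sb cb]
  |a [sa ca]|a [sa ca]|a [sa ca]|a [sa ca]] //=.
- by split=> -[W Ww] /=; split=> //; [move=> _; exact: (ultra_top Ww)
    |exact: (ultra_bot Ww)].
- by split=> -[W Ww] /=; split=> //; [exact: (ultra_bot Ww)
    |move=> _; exact: (ultra_top Ww)].
- have meetP U : sat canonical_model a U /\ sat canonical_model b U <->
      sval U (a ⊓ b).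
    by rewrite sa sb; apply: iff_sym; exact: (ultra_meetP _ _ (svalP U)).
  split=> // V; rewrite -inc_lower; last by apply: prov_ax; constructor.
  by split=> h U /meetP; exact: h.
- have joinP V : cosat canonical_model a V /\ cosat canonical_model b V <->
      sval V (a ⊔ b).
    by rewrite ca cb; apply: iff_sym; exact: (ultra_meetP _ _ (svalP V)).
  split=> // U; rewrite -inc_upper; last by apply: prov_ax; constructor.
  by split=> h V /joinP; exact: h.
- have negP U : ~ sat canonical_model a U <-> sval U (¬ a).
    by rewrite sa; apply: iff_sym; exact: (ultra_negP _ (svalP U)).
  split=> // V; rewrite -inc_lower; last exact: (neg_idem lower).
  by split=> h U /negP; exact: h.
- have oppP V : ~ cosat canonical_model a V <-> sval V (⌟ a).
    by rewrite ca; apply: iff_sym; exact: (ultra_negP _ (svalP V)).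
  split=> // U; rewrite -inc_upper; last exact: (neg_idem upper).
  by split=> h V /oppP; exact: h.
- have boxP (U : obj canonical_context) :
      (forall U', relR U U' -> sat canonical_model a U') <-> sval U (□ a).
    apply: iff_trans (ultra_boxP a (svalP U)).
    split=> [h U' U'u UU'|h [U' U'u] UU']; last by apply/sa; exact: h.
    by have /sa := h (exist _ U' U'u) UU'.
  split=> // V; rewrite -inc_lower; last exact: (box_meet_idem lower).
  by split=> h U /boxP; exact: h.
- have bboxP (V : Defs.prop canonical_context) :
      (forall V', relS V V' -> cosat canonical_model a V') <-> sval V (■ a).
    apply: iff_trans (ultra_boxP a (svalP V)).
    split=> [h V' V'u VV'|h [V' V'u] VV']; last by apply/ca; exact: h.
    by have /ca := h (exist _ V' V'u) VV'.
  split=> // U; rewrite -inc_upper; last exact: (box_meet_idem upper).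
  by split=> h V /bboxP; exact: h.
Qed.

(** The two halves yield only [a ⊓ a ⊢ b] and [a ⊢ b ⊔ b]. These give the second and third premises
    of [pr_order]; the other two hold for all [a] and [b]. *)
Lemma canonical_complete s : sat_sequent canonical_model s -> provable [:: s].
Proof.
case: s => a b [sab cba].
have aab : prov (a ⊓ a) b.
  apply: (@ultra_complete _ lower) => U Uu Ua.
  by apply/((truth b).1 (exist _ U Uu))/sab/((truth a).1 (exist _ U Uu)).
have abb : prov a (b ⊔ b).
  apply: (@ultra_complete _ upper) => V Vu Vb.
  by apply/((truth a).2 (exist _ V Vu))/cba/((truth b).2 (exist _ V Vu)).
apply: (@pr_order [::] [::] [::] [::] [::] [::] [::] [::] a b).
- by apply: (@meet_idem_le _ lower); exact: (meet_lel lower).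
- by apply: (@meet_idem_le _ lower) => //; exact: (meet_lel lower).
- by apply: (@meet_idem_le _ upper b b) => //; exact: (meet_lel upper).
- by apply: (@meet_idem_le _ upper a b); exact: (meet_ler upper).
Qed.

Lemma provable_component s H : List.In s H -> provable [:: s] -> provable H.
Proof.
move=> sH ps; have [B [C ->]] := List.in_split _ _ sH.
have := @pr_exchange [::] C [:: s] B; apply.
by apply: (@pr_weakening [:: s] (B ++ C)).
Qed.

Theorem theorem81 (H : hypersequent) :
  valid (@setT kripke_context) H -> provable H.
Proof.
move=> /(_ canonical_context I canonical_model)[s sH].
by move=> /canonical_complete; exact: provable_component.
Qed.
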